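(* Any exact dimensional measure $\mu$ on $\mathbb R^d$ of dimension $0$ is not quasi-decaying.
   Context: All measures and sets are assumed to be Borel, and measures are assumed to be locally finite. A measure $\mu$ on $\mathbb R^d$ is called exact dimensional of dimension $\delta$ if for $\mu$-a.e. $x\in\mathbb R^d$, $\lim_{\rho\searrow0}\frac{\log\mu(B(x,\rho))}{\log\rho}=\delta$, where $B(x,\rho)$ denotes the ball of radius $\rho$ centered at $x$. For $S\subset\mathbb R^d$ and $r\ge0$, $\mathcal N(S,r)=\{x\in\mathbb R^d:\mathrm{dist}(x,S)\le r\}$ is the closed $r$-thickening of $S$; $\mathscr H$ is the collection of affine hyperplanes in $\mathbb R^d$. Given a measure $\mu$ on $\mathbb R^d$ and $x\in E\subset\mathbb R^d$, $\mu$ is quasi-decaying at $x$ relative to $E$ if for all $\gamma>0$ there exist $C_1,\alpha>0$ such that for all $0<\rho\le1$, $0<\beta\le\rho^\gamma$ and $L\in\mathscr H$, if $B=B(x,\rho)$ then $\mu(\mathcal N(L,\beta\rho)\cap B\cap E)\le C_1\beta^\alpha\mu(B)$. $\mu$ is quasi-decaying relative to $E$ if for $\mu$-a.e. $x\in E$, $\mu$ is quasi-decaying at $x$ relative to $E$. Finally, $\mu$ is quasi-decaying if there exists a sequence $(E_n)_n$ such that $\mu(\mathbb R^d\setminus\bigcup_nE_n)=0$ and for each $n$, $\mu$ is quasi-decaying relative to $E_n$. *)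

(* Defs.v *)
From mathcomp Require Import all_boot all_order all_algebra.
From mathcomp Require Import all_classical all_reals all_analysis.
Set Implicit Arguments.
Unset Strict Implicit.
Unset Printing Implicit Defensive.
Import Order.TTheory GRing.Theory Num.Theory.
Import numFieldNormedType.Exports.
Local Open Scope classical_set_scope.
Local Open Scope ring_scope.

(* R^d with its Borel sigma-algebra. The topology of 'rV[R]_d is the one of
   the sup norm, hence the usual one; the library norm `|x| is the sup norm,
   so the Euclidean norm is defined separately. *)
Notation borelRd R d := (g_sigma_algebraType (@open 'rV[R]_d)).

Section Geometry.
Context {R : realType} {d : nat}.
Implicit Types (x y v : 'rV[R]_d) (S L : set 'rV[R]_d).

Definition dotv x y : R := \sum_(i < d) x ord0 i * y ord0 i.

Definition enorm x : R := Num.sqrt (dotv x x).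

Definition cball x (rho : R) : set 'rV[R]_d := [set y | enorm (y - x) <= rho].

(* The distance is extended-real so that dist(x, set0) = +oo. *)
Definition dist_to x S : \bar R :=
  ereal_inf [set (enorm (x - y))%:E | y in S].

Definition thickening S (r : R) : set 'rV[R]_d :=
  [set x | (dist_to x S <= r%:E)%E].

Definition hyperplane L : Prop :=
  exists v (c : R), v != 0 /\ L = [set x | dotv v x = c].

End Geometry.

Section Measures.
Context {R : realType} {d : nat}.
Variable mu : {measure set (borelRd R d) -> \bar R}.

Definition locally_finite : Prop :=
  forall x : 'rV[R]_d, exists2 U : set 'rV[R]_d,
    open_nbhs x U & (mu U < +oo)%E.

(* [lne] is the extended logarithm: lne 0 = -oo, so that the quotient is +oo
   for small rho when x lies outside the support of mu. *)
Definition exact_dimensional (delta : R) : Prop :=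
  {ae mu, forall x : 'rV[R]_d,
    (lne (mu (cball x rho)) * ((ln rho)^-1)%:E)%E @[rho --> 0^'+]
      --> delta%:E}.

Definition quasi_decaying_at (E : set 'rV[R]_d) (x : 'rV[R]_d) : Prop :=
  forall gamma : R, 0 < gamma ->
  exists C1 alpha : R, [/\ 0 < C1, 0 < alpha &
    forall (rho beta : R) (L : set 'rV[R]_d),
      0 < rho <= 1 -> 0 < beta <= rho `^ gamma -> hyperplane L ->
      (mu (thickening L (beta * rho) `&` cball x rho `&` E)
        <= (C1 * beta `^ alpha)%:E * mu (cball x rho))%E].

Definition quasi_decaying_rel (E : set 'rV[R]_d) : Prop :=
  {ae mu, forall x : 'rV[R]_d, E x -> quasi_decaying_at E x}.

Definition quasi_decaying : Prop :=
  exists E : nat -> set (borelRd R d),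
    [/\ forall n, measurable (E n),
        mu (~` \bigcup_n E n) = 0%E &
        forall n, quasi_decaying_rel (E n)].

End Measures.

(* Main.v *)
Require Import Defs.
From mathcomp Require Import all_boot all_order all_algebra.
From mathcomp Require Import all_classical all_reals all_analysis.
From mathcomp Require Import ring lra.
Import Order.TTheory GRing.Theory Num.Theory.
Import numFieldNormedType.Exports.
Local Open Scope classical_set_scope.
Local Open Scope ring_scope.

(** Why the theorem holds. Let E be one of the sets relative to which [mu] is
    quasi-decaying, and let x be a point of E at which both the decay and the
    dimension hypotheses hold. Every ball centred at x lies in a thickening of
    a hyperplane through x; taking exponent gamma = 1, that is beta = rho, the
    decay inequality becomes a Frostman-type upper bound
    mu(B(x, rho^2) & E) <= C rho^a for some a > 0 ([qd_ball]). On the other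
    hand dimension 0 means that mu(B(x, r)) eventually exceeds every positive
    power of r ([dim0_ball]).

    The first bound concerns the restriction of [mu] to E and the second one
    [mu] itself; they are confronted without any density theorem, by counting.
    Let A be a set of such points, on which the constants are uniform. In a
    maximal t-separated subset of A the balls of radius t / 3 are disjoint and
    each has mass at least l, so there are at most M / l of them, M being the
    mass of a bounded neighbourhood of A; the balls of radius t around the same
    points cover A, so A sits in a set of mass at most (M / l) u, where u bounds
    the mass that a ball of radius t gives to E ([cover_measure_le]). With
    t = rho^2, l = rho^b and u = C rho^(2 b) this is M C rho^b, which tends to
    0 with rho: A is negligible ([negligible_uniform]).

    Countably many choices of the constants exhaust almost all of E
    ([mem_decay_piece]), so each E is null, and so is their union, which
    carries [mu]. The pieces need not be measurable: negligibility only asks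
    for a null measurable superset, which the covering argument provides. *)

(** * Euclidean geometry of R^d *)

Section Euclid.
Context {R : realType} {d : nat}.
Implicit Types (x y z v : 'rV[R]_d).

Lemma dotv_ge0 v : 0 <= dotv v v.
Proof. by apply: sumr_ge0 => i _; rewrite -expr2 sqr_ge0. Qed.

Lemma le_enorm v (r : R) : 0 <= r -> (enorm v <= r) = (dotv v v <= r ^+ 2).
Proof.
by move=> r0; rewrite -ler_sqr ?nnegrE ?sqr_sqrtr ?dotv_ge0 ?sqrtr_ge0.
Qed.

Lemma enormB x y : enorm (x - y) = enorm (y - x).
Proof.
rewrite /enorm /dotv; congr Num.sqrt; apply: eq_bigr => i _.
by rewrite !mxE; ring.
Qed.

(** A triangle inequality for squared distances that follows from
    (s + t)^2 <= 2 (s^2 + t^2) coordinatewise, without Cauchy-Schwarz. The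
    factor 2 it loses is why balls of radius t / 3 are used below around
    t-separated points. *)
Lemma dotv_dist_le x y z :
  dotv (x - z) (x - z) <= 2 * (dotv (x - y) (x - y) + dotv (y - z) (y - z)).
Proof.
rewrite /dotv -big_split/= mulr_sumr; apply: ler_sum => i _; rewrite !mxE.
set a := x _ _; set b := y _ _; set c := z _ _.
rewrite -subr_ge0 (_ : _ - _ = ((a - b) - (b - c)) ^+ 2) ?sqr_ge0//; ring.
Qed.

Lemma cball_disjoint x y (t : R) : 0 <= t -> t < enorm (x - y) ->
  cball x (t / 3) `&` cball y (t / 3) = set0.
Proof.
move=> t0 txy; apply/seteqP; split => // z []; rewrite /cball /=.
have t30 : 0 <= t / 3 by rewrite divr_ge0.
rewrite enormB !le_enorm// => xz zy; exfalso.
move: txy; rewrite ltNge le_enorm// => /negP; apply.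
rewrite (le_trans (dotv_dist_le x z y))//.
move: xz zy; set a := dotv _ _; set b := dotv _ _; nra.
Qed.

Lemma enorm_continuous x : continuous (fun y => enorm (y - x)).
Proof.
move=> y; apply: (@continuous_comp _ _ _ (fun y => dotv (y - x) (y - x))).
  move: y; apply: (@continuous_big R); first exact: add_continuous.
  move=> i _ y; suff cB : {for y, continuous (fun y => (y - x) ord0 i)}.
    exact: (@continuousM R _ _ _ y cB cB).
  rewrite (_ : (fun y => _) = (fun y => y ord0 i - x ord0 i)).
    exact: (cvgB (@coord_continuous R 1 d ord0 i y) (cvg_cst _)).
  by apply/funext => z; rewrite !mxE.
exact: sqrt_continuous.
Qed.

Lemma closed_cball x (r : R) : closed (cball x r).
Proof.
have /continuous_closedP := enorm_continuous x.
by move=> /(_ [set z | z <= r]); apply; exact: closed_le.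
Qed.

Lemma coord_le_enorm v i : `|v ord0 i| <= enorm v.
Proof.
rewrite -sqrtr_sqr ler_wsqrtr//.
rewrite /dotv (bigD1 i)//= -expr2 lerDl.
by apply: sumr_ge0 => j _; rewrite -expr2 sqr_ge0.
Qed.

Lemma norm_le_enorm v : `|v| <= enorm v.
Proof.
rewrite (_ : `|v| = mx_norm v)// mx_normrE; apply/bigmax_leP => /=; split.
  exact: sqrtr_ge0.
by move=> [i j] _ /=; rewrite ord1; exact: coord_le_enorm.
Qed.

Lemma coord_hyperplane (i : 'I_d) (c : R) :
  hyperplane [set y : 'rV[R]_d | y ord0 i = c].
Proof.
exists (delta_mx ord0 i), c; split.
  apply/eqP => /matrixP/(_ ord0 i); rewrite !mxE !eqxx.
  by move/eqP; rewrite oner_eq0.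
apply/seteqP; suff dotE y : dotv (delta_mx ord0 i) y = y ord0 i.
  by split => y /=; rewrite dotE.
rewrite /dotv (bigD1 i)//= big1 ?addr0 ?mxE ?eqxx ?mul1r// => j ji.
by rewrite mxE eqxx (negbTE ji) mul0r.
Qed.

(** The decay inequality mentions the measure of a thickening, which can be
    compared with smaller sets only once the thickening is known to be Borel.
    For a coordinate hyperplane it is an explicit slab, so one hyperplane of
    this kind through each point is enough. *)
Lemma thickening_coord_hyperplane (i : 'I_d) (c r : R) :
  thickening [set y : 'rV[R]_d | y ord0 i = c] r =
  [set y : 'rV[R]_d | `|y ord0 i - c| <= r].
Proof.
rewrite /thickening; suff distE y :
    dist_to y [set z : 'rV[R]_d | z ord0 i = c] = `|y ord0 i - c|%:E.
  by apply/seteqP; split => y /=; rewrite distE lee_fin.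
apply/eqP; rewrite eq_le; apply/andP; split; last first.
  apply/ereal_infP => _ [z /= <- <-]; rewrite lee_fin.
  by have := coord_le_enorm (y - z) i; rewrite !mxE.
apply: ge_ereal_inf; exists `|y ord0 i - c|%:E => //=.
(* the orthogonal projection of y onto the hyperplane *)
exists (y - (y ord0 i - c) *: delta_mx ord0 i) => /=.
  by rewrite !mxE !eqxx mulr1 subKr.
rewrite subKr -sqrtr_sqr /enorm /dotv (bigD1 i)//= big1 ?addr0; last first.
  by move=> j ji; rewrite !mxE eqxx (negbTE ji) !mulr0.
by rewrite !mxE !eqxx mulr1 expr2.
Qed.

(** Boundedness and compactness in R^d refer to the sup norm `|x|; this transfers
    them to Euclidean balls. *)
Lemma cball_norm_le x (r : R) : cball x r `<=` [set y | `|y| <= `|x| + r].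
Proof.
move=> y; rewrite /cball /= => yx.
rewrite -(subrKC x y) (le_trans (ler_normD _ _))// lerD//.
exact: le_trans (norm_le_enorm _) yx.
Qed.

Lemma cball_subset x (r s : R) : r <= s -> cball x r `<=` cball x s.
Proof. by move=> rs y; rewrite /cball/= => /le_trans; apply. Qed.

Lemma norm_ball_compact (r : R) : compact [set y : 'rV[R]_d | `|y| <= r].
Proof.
apply: bounded_closed_compact.
  by exists r; split; [exact: num_real|move=> M /ltW rM y /= /le_trans; apply].
have /continuous_closedP := @norm_continuous R 'rV[R]_d.
by move=> /(_ [set z | z <= r]); apply; exact: closed_le.
Qed.

Lemma cball_compact x (r : R) : compact (cball x r).
Proof.
apply: (subclosed_compact _ (norm_ball_compact (`|x| + r))).
  exact: closed_cball.
exact: cball_norm_le.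
Qed.

End Euclid.

(** * Borel sets and locally finite measures *)

Section Borel.
Context {R : realType} {d : nat}.

Lemma open_borel (U : set 'rV[R]_d) :
  open U -> measurable (U : set (borelRd R d)).
Proof. by move=> oU; exact: sub_sigma_algebra. Qed.

Lemma closed_borel (F : set 'rV[R]_d) :
  closed F -> measurable (F : set (borelRd R d)).
Proof.
move=> cF; rewrite -[F]setCK; apply: measurableC; apply: open_borel.
exact: closed_openC.
Qed.

Lemma cball_borel x (r : R) : measurable (cball x r : set (borelRd R d)).
Proof. by apply: closed_borel; exact: closed_cball. Qed.

Lemma compact_borel (K : set 'rV[R]_d) :
  compact K -> measurable (K : set (borelRd R d)).
Proof.
move=> cK; apply: closed_borel.
by apply: compact_closed => //; exact: norm_hausdorff.
Qed.

Lemma slab_borel (i : 'I_d) (c r : R) :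
  measurable ([set y | `|y ord0 i - c| <= r] : set (borelRd R d)).
Proof.
apply: closed_borel; have cf : continuous (fun y : 'rV[R]_d => `|y ord0 i - c|).
  move=> y.
  exact: (cvg_norm (cvgB (@coord_continuous R 1 d ord0 i y) (cvg_cst _))).
by have /continuous_closedP/(_ [set z | z <= r]) := cf; apply; exact: closed_le.
Qed.

Variable mu : {measure set (borelRd R d) -> \bar R}.

Lemma locally_finite_compact (K : set 'rV[R]_d) : locally_finite mu ->
  compact K -> (mu K < +oo)%E.
Proof.
move=> lf cK.
have [U hU] : {U : 'rV[R]_d -> set 'rV[R]_d &
    forall x, open_nbhs x (U x) /\ (mu (U x) < +oo)%E}.
  by apply: (@choice _ _ (fun x V => open_nbhs x V /\ (mu V < +oo)%E)) => x;
     have [V ? ?] := lf x; exists V.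
have cmpK := cK; rewrite compact_cover in cmpK.
have [x _|x Kx|D _ KD] := cmpK _ K U.
- by have [[]] := hU x.
- by exists x => //; have [[]] := hU x.
have oU x : measurable (U x : set (borelRd R d)).
  by apply: open_borel; have [[]] := hU x.
rewrite /cover bigcup_fset in KD.
apply: (@le_lt_trans _ _ (mu (\big[setU/set0]_(i <- finmap.enum_fset D) U i))).
  rewrite le_measure// inE.
  - exact: compact_borel.
  - exact: bigsetU_measurable.
elim: (finmap.enum_fset D) => [|y s IH]; first by rewrite big_nil measure0.
rewrite big_cons (le_lt_trans (measureU2 _ _ _))//.
  exact: bigsetU_measurable.
by rewrite lte_add_pinfty//; have [] := hU y.
Qed.

End Borel.

(** * Covering by balls and negligible sets *)

Section Cover.
Context {R : realType} {d : nat}.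
Variable mu : {measure set (borelRd R d) -> \bar R}.

Definition separated (t : R) (s : seq 'rV[R]_d) : bool :=
  pairwise (fun x y => t < enorm (x - y)) s.

(** Packing: the balls of radius t / 3 around t-separated points are disjoint,
    so their masses add up. *)
Lemma separated_size_le (t l : R) (s : seq 'rV[R]_d) : 0 <= t ->
  separated t s ->
  (forall x, x \in s -> (l%:E <= mu (cball x (t / 3)))%E) ->
  (((size s)%:R * l)%:E <= mu (\big[setU/set0]_(x <- s) cball x (t / 3)))%E.
Proof.
move=> t0; elim: s => [|x s IH] /=; first by rewrite mul0r big_nil measure0.
move=> /andP[/allP xs ss] hl; rewrite big_cons measureU.
- rewrite -nat1r mulrDl mul1r EFinD leeD//.
    by apply: hl; rewrite mem_head.
  by apply: IH => // y ys; apply: hl; rewrite inE ys orbT.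
- exact: cball_borel.
- by apply: bigsetU_measurable => y _; exact: cball_borel.
- rewrite -bigcup_seq setI_bigcupr bigcup0// => y /= /xs.
  exact: cball_disjoint.
Qed.

(** The counting argument. The lower bound l limits the number of t-separated
    points of A by M / l; a separated family of maximal size is a t-net of A,
    and intersecting its balls with E lets each of them cost only u. *)
Lemma cover_measure_le (E W : set (borelRd R d)) (A : set 'rV[R]_d)
    (t l u M : R) : measurable E -> measurable W -> (mu W <= M%:E)%E ->
  0 <= t -> 0 < l -> 0 <= u -> A `<=` E ->
  (forall x, A x -> [/\ cball x (t / 3) `<=` W,
     (l%:E <= mu (cball x (t / 3)))%E & (mu (cball x t `&` E) <= u%:E)%E]) ->
  exists U : set (borelRd R d),
    [/\ measurable U, A `<=` U & (mu U <= (M / l * u)%:E)%E].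
Proof.
move=> mE mW WM t0 l0 u0 AE Ah.
have card_le s : separated t s -> {in s, forall x, A x} ->
    (size s)%:R <= M / l.
  move=> ss sA; rewrite ler_pdivlMr// -lee_fin (le_trans _ WM)//.
  apply: (le_trans (separated_size_le _ _ _ t0 ss _)) => //.
    by move=> x /sA/Ah[].
  rewrite le_measure// ?inE//.
    by apply: bigsetU_measurable => x _; exact: cball_borel.
  by rewrite -bigcup_seq => y [x /= /sA/Ah[xW _ _]]; exact: xW.
pose P n := `[< exists s, [/\ size s = n, separated t s &
                            {in s, forall x, A x}] >].
have exP : exists n, P n by exists 0%N; apply/asboolP; exists [::].
have Pub n : P n -> (n <= Num.trunc (M / l))%N.
  move=> /asboolP[s [<- ss sA]]; rewrite truncn_ge_nat ?card_le//.
  by rewrite (le_trans _ (card_le _ ss sA)).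
have [n /asboolP[s [sn ss sA]] nmax] := ex_maxnP exP Pub.
exists (\big[setU/set0]_(x <- s) (cball x t `&` E)); split.
- apply: bigsetU_measurable => x _.
  by apply: measurableI => //; exact: cball_borel.
- move=> x Ax; rewrite -bigcup_seq; apply: contrapT => nx.
  (* an uncovered point could be added to the maximal family *)
  suff /nmax : P n.+1 by rewrite ltnn.
  apply/asboolP; exists (x :: s); split; first by rewrite /= sn.
    rewrite /separated /= -/(separated t s) ss andbT; apply/allP => y ys.
    rewrite ltNge; apply/negP => xy; apply: nx; exists y => //; split.
      exact: xy.
    exact: AE.
  by move=> y; rewrite inE => /predU1P[->//|]; exact: sA.
- apply: (@le_trans _ _ ((size s)%:R * u)%:E); last first.
    by rewrite lee_fin ler_wpM2r// card_le.
  elim: s sA {ss sn nmax} => [|x s IH] sA.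
    by rewrite big_nil measure0 mul0r.
  rewrite big_cons (le_trans (measureU2 _ _ _))//.
  + by apply: measurableI => //; exact: cball_borel.
  + apply: bigsetU_measurable => y _.
    by apply: measurableI => //; exact: cball_borel.
  + rewrite /= -nat1r mulrDl mul1r EFinD leeD//.
      by have [] := Ah x (sA _ (mem_head _ _)).
    by apply: IH => y ys; apply: sA; rewrite inE ys orbT.
Qed.

Lemma negligible_small (A : set (borelRd R d)) :
  (forall e : R, 0 < e -> exists U : set (borelRd R d),
    [/\ measurable U, A `<=` U & (mu U <= e%:E)%E]) -> mu.-negligible A.
Proof.
move=> small.
have [U hU] : {U : nat -> set (borelRd R d) & forall n, [/\ measurable (U n),
    A `<=` U n & (mu (U n) <= (n.+1%:R^-1)%:E)%E]}.
  apply: (@choice _ _ (fun n V => [/\ measurable V, A `<=` V &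
    (mu V <= (n.+1%:R^-1)%:E)%E])) => n.
  by apply: small; rewrite invr_gt0.
have mU : measurable (\bigcap_n U n).
  by apply: bigcap_measurable => // n _; have [] := hU n.
exists (\bigcap_n U n); split => //; last first.
  by move=> x Ax n _; have [_ /(_ x Ax)] := hU n.
apply/eqP; rewrite eq_le measure_ge0 andbT; apply/lee_addgt0Pr => e e0.
rewrite add0e; pose n := Num.trunc e^-1.
have [mUn _ Un] := hU n.
apply: (@le_trans _ _ (mu (U n))).
  by rewrite le_measure ?inE//; exact: bigcap_inf.
rewrite (le_trans Un)// lee_fin invf_ple ?posrE//.
by rewrite ltW// truncnS_gt.
Qed.

(** Opposite bounds with uniform constants cannot coexist on a set of positive
    mass: at scale rho^2 there are at most M / rho^a balls to consider, each
    carrying at most C rho^(2 a) of the mass of E. The radii are squares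
    because this is the form in which the decay hypothesis gives the upper
    bound. *)
Lemma negligible_uniform (E W : set (borelRd R d)) (A : set 'rV[R]_d)
    (a r0 C M : R) : measurable E -> measurable W -> (mu W <= M%:E)%E ->
  0 < a -> 0 < r0 <= 1 -> 0 <= C -> A `<=` E ->
  (forall x, A x -> cball x 1 `<=` W) ->
  (forall x rho, A x -> 0 < rho <= r0 ->
    ((rho `^ a)%:E <= mu (cball x (rho ^+ 2 / 3)))%E /\
    (mu (cball x (rho ^+ 2) `&` E) <= (C * rho `^ (2 * a))%:E)%E) ->
  mu.-negligible (A : set (borelRd R d)).
Proof.
move=> mE mW WM a0 /andP[r00 r01] C0 AE AW Ah; apply: negligible_small => e e0.
have M0 : 0 <= M by rewrite -lee_fin (le_trans _ WM).
have MC0 : 0 <= M * C by rewrite mulr_ge0.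
have e1 : 0 < e / (M * C + 1) by rewrite divr_gt0// ltr_wpDl.
near (0 : R)^'+ => rho.
have rho0 : 0 < rho by [].
have rhor : rho <= r0 by near: rho; exact: nbhs_right_le.
have rhoe : rho `^ a <= e / (M * C + 1).
  near: rho; have := powR_cvg0 a0; move=> /cvgr_le; exact.
have balls x : A x -> [/\ cball x (rho ^+ 2 / 3) `<=` W,
    ((rho `^ a)%:E <= mu (cball x (rho ^+ 2 / 3)))%E &
    (mu (cball x (rho ^+ 2) `&` E) <= (C * rho `^ (2 * a))%:E)%E].
  move=> Ax; have [|? ?] := Ah x rho Ax; first by rewrite rho0.
  split => //; apply: subset_trans (AW x Ax); apply: cball_subset.
  rewrite ler_pdivrMr// mul1r (@le_trans _ _ 1)// ?ler1n//.
  by rewrite exprn_ile1// ?ltW// (le_trans rhor).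
have [U [mU AU Ule]] := cover_measure_le _ _ _ _ _ _ _ mE mW WM
  (sqr_ge0 rho) (powR_gt0 a rho0) (mulr_ge0 C0 (powR_ge0 _ _)) AE balls.
exists U; split => //; rewrite (le_trans Ule)// lee_fin.
have -> : M / rho `^ a * (C * rho `^ (2 * a)) = M * C * rho `^ a.
  rewrite (_ : 2 * a = a + a); last by ring.
  rewrite powRD; last by rewrite (gt_eqF rho0) implybT.
  have : rho `^ a != 0 by rewrite gt_eqF// powR_gt0.
  by move=> ?; field.
rewrite (le_trans (ler_wpM2l MC0 rhoe))// mulrCA ger_pMr//.
by rewrite ler_pdivrMr ?mul1r ?lerDl// ltr_wpDl.
Unshelve. all: end_near. Qed.

(** * Consequences of the two hypotheses at a point *)

(** Since ln r < 0 for r < 1, the quotient lne (mu (cball x r)) / ln r being below eps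
    says exactly that the ball has more mass than r^eps. *)
Lemma dim0_ball (x : 'rV[R]_d) (eps : R) : 0 < eps ->
  (lne (mu (cball x rho)) * ((ln rho)^-1)%:E)%E @[rho --> 0^'+] --> 0%:E ->
  \forall r \near 0^'+, ((r `^ eps)%:E <= mu (cball x r))%E.
Proof.
move=> eps0 cv.
have /cv : nbhs (0%:E : \bar R) [set y | (y < eps%:E)%E].
  by apply: open_ereal_lt'; rewrite lte_fin.
rewrite /= !near_simpl => near_lt.
near=> r.
have r0 : 0 < r by [].
have r1 : r < 1 by near: r; exact: nbhs_right_lt.
have lnr : ln r < 0 by rewrite ln_lt0// r0.
have : (lne (mu (cball x r)) * ((ln r)^-1)%:E < eps%:E)%E by near: r.
apply: contraTT; rewrite -ltNge -leNgt => mur.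
rewrite (_ : eps%:E = ((eps * ln r)%:E * ((ln r)^-1)%:E)%E); last first.
  by rewrite -EFinM mulfK// lt_eqF.
rewrite -leeN2 -!muleN -EFinN; apply: lee_wpmul2r.
  by rewrite lee_fin oppr_ge0 invr_le0 ltW.
rewrite -ln_powR -lne_EFin ?powR_gt0// lee_lne ?ltW// in_itv/= leey andbT//.
by rewrite lee_fin powR_ge0.
Unshelve. all: end_near. Qed.

(** Quasi-decay with gamma = 1 and beta = rho, applied to a hyperplane through
    x: its thickening of width rho^2 contains the ball of radius rho^2. *)
Lemma qd_ball (E : set (borelRd R d)) (x : 'rV[R]_d) : (0 < d)%N ->
  measurable E -> quasi_decaying_at mu E x ->
  exists C a : R, [/\ 0 < C, 0 < a & forall rho, 0 < rho <= 1 ->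
    (mu (cball x (rho ^+ 2) `&` E) <= (C * rho `^ a)%:E * mu (cball x 1))%E].
Proof.
move=> d0 mE /(_ 1 ltr01)[C [a [C0 a0 hC]]]; exists C, a; split => // rho rho1.
have /andP[rho_gt0 rho_le1] := rho1.
have sq_le : rho ^+ 2 <= rho by rewrite expr2 ler_piMl// ltW.
pose i := Ordinal d0.
have beta_le : 0 < rho <= rho `^ 1.
  by rewrite (powRr1 (ltW rho_gt0)) rho_gt0 lexx.
have := hC rho rho _ rho1 beta_le (coord_hyperplane i (x ord0 i)).
rewrite thickening_coord_hyperplane => hT.
apply: le_trans (le_trans hT _); last first.
  apply: lee_wpmul2l; first by rewrite lee_fin mulr_ge0 ?powR_ge0 ?ltW.
  rewrite le_measure ?inE//; [exact: cball_borel..|exact: cball_subset].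
rewrite le_measure ?inE//.
- by apply: measurableI => //; exact: cball_borel.
- apply: measurableI => //; apply: measurableI; last exact: cball_borel.
  exact: slab_borel.
- move=> y [yx Ey]; split => //; split; last exact: cball_subset yx.
  move: yx; rewrite /cball /= -expr2; apply: le_trans.
  by have := coord_le_enorm (y - x) i; rewrite !mxE.
Qed.

End Cover.

(** * Countable decomposition into uniform pieces *)

Section Pieces.
Context {R : realType} {d : nat}.
Variable mu : {measure set (borelRd R d) -> \bar R}.

(** The parameter m quantizes the exponent, as 1 / (m + 1), and k bounds at once
    the position of x, the multiplicative constant, and the inverse of the
    scale below which the estimates hold. *)
Definition decay_piece (E : set (borelRd R d)) (m k : nat) : set 'rV[R]_d :=
  [set x | [/\ E x, `|x| <= k%:R & forall rho : R, 0 < rho <= k.+1%:R^-1 ->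
    ((rho `^ m.+1%:R^-1)%:E <= mu (cball x (rho ^+ 2 / 3)))%E /\
    (mu (cball x (rho ^+ 2) `&` E) <=
      (k%:R * rho `^ (2 * m.+1%:R^-1))%:E)%E]].

Lemma decay_piece_negligible E m k : locally_finite mu -> measurable E ->
  mu.-negligible (decay_piece E m k : set (borelRd R d)).
Proof.
move=> lf mE; pose W := [set y : 'rV[R]_d | `|y| <= k%:R + 1].
have cW : compact W by exact: norm_ball_compact.
have mW : measurable (W : set (borelRd R d)).
  exact: compact_borel.
have finW : mu W \is a fin_num.
  by rewrite ge0_fin_numE ?measure_ge0//; exact: locally_finite_compact.
apply: (@negligible_uniform _ _ mu E W _ m.+1%:R^-1 k.+1%:R^-1 k%:R
  (fine (mu W))) => //.
- by rewrite fineK.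
- by rewrite invr_gt0 ltr0n/= invf_le1 ?ler1n ?ltr0n.
- by move=> x [].
- move=> x [_ xk _] y /cball_norm_le /= /le_trans; apply.
  by rewrite lerD2r.
- by move=> x rho [_ _ h] /h.
Qed.

(** The exponents can be made 1 / (m + 1) below and 2 / (m + 1) above for some m:
    [dim0_ball] allows any positive exponent, and the exponent a of [qd_ball]
    may be replaced by any smaller one for radii at most 1. *)
Lemma mem_decay_piece (E : set (borelRd R d)) (x : 'rV[R]_d) : (0 < d)%N ->
  locally_finite mu -> measurable E -> E x -> quasi_decaying_at mu E x ->
  (lne (mu (cball x rho)) * ((ln rho)^-1)%:E)%E @[rho --> 0^'+] --> 0%:E ->
  exists m k, decay_piece E m k x.
Proof.
move=> d0 lf mE Ex qd dim0.
have [C [a [C0 a0 hC]]] := qd_ball mu E x d0 mE qd.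
pose m := Num.trunc (2 / a); pose b : R := m.+1%:R^-1.
have b0 : 0 < b by rewrite invr_gt0.
have ba : 2 * b <= a.
  rewrite /b ler_pdivrMr// mulrC -ler_pdivrMr//.
  by rewrite ltW// truncnS_gt.
have b30 : 0 < b / 3 by rewrite divr_gt0.
(* The exponent b / 3 anticipates rho ^+ 2 / 3 >= rho ^+ 3. *)
have [e /= e0 he] := dim0_ball mu x _ b30 dim0.
have finB : mu (cball x 1) \is a fin_num.
  rewrite ge0_fin_numE ?measure_ge0//; apply: locally_finite_compact => //.
  exact: cball_compact.
pose D := C * fine (mu (cball x 1)).
have D0 : 0 <= D by apply: mulr_ge0; [exact: ltW|exact: fine_ge0].
(* k.+1 exceeds the norm of x, the constant D, the inverse of the radius e
   and 3, the last one to have rho <= 1 / 3. *)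
pose k := Num.trunc (`|x| + D + e^-1 + 3).
exists m, k.+1.
have kgt : `|x| + D + e^-1 + 3 < k.+1%:R by exact: truncnS_gt.
have x0 : 0 <= `|x| by [].
have ei0 : 0 < e^-1 by rewrite invr_gt0.
split => //; first by lra.
move=> rho /andP[rho0 rhok].
have k20 : (0 : R) < k.+2%:R by [].
have k12 : (k.+1%:R : R) <= k.+2%:R by rewrite ler_nat.
have rho3 : rho <= 3^-1.
  by rewrite (le_trans rhok)// lef_pV2 ?posrE//; lra.
have rhoe : rho < e.
  rewrite (le_lt_trans rhok)// invf_plt ?posrE//; lra.
have rho1 : rho <= 1 by lra.
split.
- have r0 : 0 < rho ^+ 2 / 3 by rewrite divr_gt0// exprn_gt0.
  have re : rho ^+ 2 / 3 < e by nra.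
  have -> : rho `^ b = (rho ^+ 3) `^ (b / 3).
    by rewrite -powR_mulrn ?(ltW rho0)// -powRrM; congr (_ `^ _); field.
  apply: (@le_trans _ _ (((rho ^+ 2 / 3) `^ (b / 3))%:E)).
    rewrite lee_fin; apply: ge0_ler_powR; rewrite ?nnegrE.
    - exact: ltW.
    - by rewrite exprn_ge0 ?(ltW rho0).
    - exact: ltW.
    - by rewrite exprSr ler_pM2l ?exprn_gt0.
  apply: he => //=.
  by rewrite sub0r normrN gtr0_norm.
- apply: (le_trans (hC rho _)); first by rewrite rho0.
  rewrite -(fineK finB) -EFinM lee_fin mulrAC -/D.
  apply: ler_pM => //; first by exact: powR_ge0.
    by lra.
  by apply: ger_powR => //; rewrite rho0.
Qed.

End Pieces.

Theorem theorem1p15 (R : realType) (d : nat) (d_gt0 : (0 < d)%N)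
    (mu : {measure set (borelRd R d) -> \bar R})
    (mu_lf : locally_finite mu) (mu_neq0 : mu [set: borelRd R d] <> 0%E)
    (mu_dim0 : exact_dimensional mu 0) :
  ~ quasi_decaying mu.
Proof.
move=> [E [mE coverE qdE]]; apply: mu_neq0.
apply/negligibleP; first exact: measurableT.
have negE n : mu.-negligible (E n).
  pose bad := ~` [set x : borelRd R d | E n x -> quasi_decaying_at mu (E n) x].
  pose baddim := ~` [set x : borelRd R d |
    (lne (mu (cball x rho)) * ((ln rho)^-1)%:E)%E @[rho --> 0^'+] --> 0%:E].
  apply: (@negligibleS _ _ _ _ (bad `|` baddim `|`
      \bigcup_m \bigcup_k (decay_piece mu (E n) m k : set (borelRd R d)))).
    move=> x Ex; have [qx|] := pselect (E n x -> quasi_decaying_at mu (E n) x);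
      last by left; left.
    have [dx|] := pselect (
      (lne (mu (cball x rho)) * ((ln rho)^-1)%:E)%E @[rho --> 0^'+] --> 0%:E);
      last by left; right.
    right; have [m [k xmk]] :=
      mem_decay_piece mu (E n) x d_gt0 mu_lf (mE n) Ex (qx Ex) dx.
    by exists m => //; exists k.
  apply: negligibleU; first by apply: negligibleU; [exact: qdE|exact: mu_dim0].
  apply: negligible_bigcup => m; apply: negligible_bigcup => k.
  exact: decay_piece_negligible.
rewrite -(setvU (\bigcup_n E n)); apply: negligibleU.
  apply/negligibleP => //; apply: measurableC; exact: bigcup_measurable.
exact: negligible_bigcup.
Qed.
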